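(* Let $C \subseteq \mathbb{D}$ be a hyperbolic convex set in the Poincaré disk and let $c \in C$. Then for any real numbers $k_1, k_2 \geqslant 1$, the image $\delta_{c,(k_1,k_2)}(C)$ of $C$ under the asymmetric hyperbolic dilation about $c$ is hyperbolic convex.
   Context: $\mathbb{D} = \{x \in \mathbb{R}^2 : \|x\| < 1\}$ is the Poincaré disk, with the hyperbolic metric of curvature $-1$. Points are written in geodesic polar coordinates centered at the origin $0$ as $X(r,\theta) = \tanh(r/2)(\cos\theta, \sin\theta)$ with $r > 0$ (and $r=0$ for the origin), so that the metric is $ds^2 = dr^2 + \sinh^2 r\, d\theta^2$ and the hyperbolic distance from $0$ to $X(r,\theta)$ is $r$. For $u,v \in \mathbb{D}$, $[u,v]$ denotes the unique hyperbolic geodesic segment joining $u$ and $v$ (geodesics are arcs in $\mathbb{D}$ of Euclidean circles orthogonal to the unit circle, including Euclidean lines through the origin). A set $C \subseteq \mathbb{D}$ is hyperbolic convex if $[u,v] \subseteq C$ for every $u,v \in C$. Asymmetric hyperbolic dilation about the origin: for $k_1,k_2 > 0$, $\delta_{0,(k_1,k_2)} : \mathbb{D} \to \mathbb{D}$ is given by $\delta_{0,(k_1,k_2)}(0) = 0$ and $\delta_{0,(k_1,k_2)}(X(r,\theta)) = X(r',\theta')$, where $r' = r\,(k_1^2\cos^2\theta + k_2^2\sin^2\theta)^{1/2}$ and $\theta'$ is the angle of the vector $(k_1\cos\theta, k_2\sin\theta)$; for $\theta \in (-\pi/2,\pi/2)$ this is $\theta' = \tan^{-1}((k_2/k_1)\tan\theta)$,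 and $\theta'=-\pi/2$ when $\theta=-\pi/2$. Equivalently, in the coordinates $(r\cos\theta, r\sin\theta) \in \mathbb{R}^2$ the map is $(a,b) \mapsto (k_1 a, k_2 b)$. Asymmetric hyperbolic dilation about $c \in \mathbb{D}$: $\delta_{c,(k_1,k_2)} = \tau_c \circ \delta_{0,(k_1,k_2)} \circ \tau_c^{-1}$, where $\tau_c : \mathbb{D} \to \mathbb{D}$ is the hyperbolic isometry $$\tau_c(x) = \frac{(1 - 2c\cdot x + \|x\|^2)\,c - (1-\|c\|^2)\,x}{1 - 2 c\cdot x + \|c\|^2\|x\|^2},$$ which swaps $0$ and $c$. *)

(* Defs.v *)
From Stdlib Require Import Reals Lra.
Open Scope R_scope.

Definition point : Type := (R * R)%type.

Definition origin : point := (0, 0).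

Definition dot (p q : point) : R := fst p * fst q + snd p * snd q.

Definition norm (p : point) : R := sqrt (dot p p).

Definition psub (p q : point) : point := (fst p - fst q, snd p - snd q).

Definition disk (p : point) : Prop := norm p < 1.

(* The circle with centre [m] and radius [rho] crosses the unit circle, and at
   each common point the two radii are perpendicular. *)
Definition orthogonal_to_unit_circle (m : point) (rho : R) : Prop :=
  (exists p, norm p = 1 /\ norm (psub p m) = rho) /\
  (forall p, norm p = 1 -> norm (psub p m) = rho -> dot p (psub p m) = 0).

(* [gamma] parametrizes a whole Euclidean circle orthogonal to the unit circle
   (by the angle at its centre) or a whole Euclidean line through the origin. *)
Definition geodesic_carrier (gamma : R -> point) : Prop :=
  (exists (m : point) (rho : R),
      0 < rho /\ orthogonal_to_unit_circle m rho /\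
      forall t, gamma t = (fst m + rho * cos t, snd m + rho * sin t))
  \/
  (exists alpha : R, forall t, gamma t = (t * cos alpha, t * sin alpha)).

(* [segment u v] is [[u,v]].  A carrier circle has two arcs with ends [u] and
   [v]; requiring the arc to stay in the disk selects the right one. *)
Definition segment (u v w : point) : Prop :=
  exists (gamma : R -> point) (a b : R),
    geodesic_carrier gamma /\ gamma a = u /\ gamma b = v /\
    (forall t, Rmin a b <= t <= Rmax a b -> disk (gamma t)) /\
    (exists t, Rmin a b <= t <= Rmax a b /\ w = gamma t).

Definition hyperbolic_convex (C : point -> Prop) : Prop :=
  (forall u, C u -> disk u) /\
  (forall u v, C u -> C v -> forall w, segment u v w -> C w).

Definition X (r theta : R) : point :=
  (tanh (r / 2) * cos theta, tanh (r / 2) * sin theta).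

(* Hyperbolic distance to the origin, [2 artanh (norm p)]. *)
Definition hdist0 (p : point) : R := ln ((1 + norm p) / (1 - norm p)).

(* The angle in [(-PI, PI]] of a nonzero vector. *)
Definition angle (p : point) : R :=
  if Rle_dec 0 (snd p) then acos (fst p / norm p) else - acos (fst p / norm p).

Definition dilation0 (k1 k2 : R) (p : point) : point :=
  if Req_EM_T (norm p) 0 then origin
  else
    let r := hdist0 p in
    let theta := angle p in
    X (r * sqrt (k1 ^ 2 * cos theta ^ 2 + k2 ^ 2 * sin theta ^ 2))
      (angle (k1 * cos theta, k2 * sin theta)).

Definition tau (c x : point) : point :=
  let A := 1 - 2 * dot c x + norm x ^ 2 in
  let B := 1 - norm c ^ 2 in
  let D := 1 - 2 * dot c x + norm c ^ 2 * norm x ^ 2 in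
  ((A * fst c - B * fst x) / D, (A * snd c - B * snd x) / D).

(* The innermost [tau c] is the inverse isometry: see [tau_involutive]. *)
Definition dilation (c : point) (k1 k2 : R) (x : point) : point :=
  tau c (dilation0 k1 k2 (tau c x)).

Definition image (f : point -> point) (C : point -> Prop) (y : point) : Prop :=
  exists x, C x /\ y = f x.

Lemma norm_sq p : norm p ^ 2 = fst p ^ 2 + snd p ^ 2.
Proof.
unfold norm, dot; rewrite pow2_sqrt; [ring | nra].
Qed.

Lemma norm_ge0 p : 0 <= norm p.
Proof. apply sqrt_pos. Qed.

Lemma tau_denominator_pos c x : disk c -> disk x ->
  0 < 1 - 2 * dot c x + norm c ^ 2 * norm x ^ 2.
Proof.
unfold disk; intros Hc Hx.
pose proof (norm_ge0 c); pose proof (norm_ge0 x).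
assert (Hlt : norm c * norm x < 1) by nra.
assert (Hd : dot c x <= norm c * norm x).
{ apply Rsqr_incr_0_var; [| now apply Rmult_le_pos].
  unfold Rsqr.
  replace (norm c * norm x * (norm c * norm x))
    with (norm c ^ 2 * norm x ^ 2) by ring.
  rewrite !norm_sq; unfold dot.
  pose proof (pow2_ge_0 (fst c * snd x - snd c * fst x)); lra. }
nra.
Qed.

Lemma norm_tau c x : disk c -> disk x ->
  1 - norm (tau c x) ^ 2 = (1 - norm c ^ 2) * (1 - norm x ^ 2)
    / (1 - 2 * dot c x + norm c ^ 2 * norm x ^ 2).
Proof.
intros Hc Hx; pose proof (tau_denominator_pos c x Hc Hx) as HD.
rewrite (norm_sq (tau c x)); unfold tau; cbn [fst snd].
unfold dot in *; rewrite !norm_sq in *; field; lra.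
Qed.

Lemma tau_disk c x : disk c -> disk x -> disk (tau c x).
Proof.
intros Hc Hx; pose proof (tau_denominator_pos c x Hc Hx) as HD.
pose proof (norm_tau c x Hc Hx) as H2.
unfold disk in *.
pose proof (norm_ge0 c); pose proof (norm_ge0 x).
assert (0 < 1 - norm c ^ 2) by nra; assert (0 < 1 - norm x ^ 2) by nra.
assert (0 < (1 - norm c ^ 2) * (1 - norm x ^ 2)
              / (1 - 2 * dot c x + norm c ^ 2 * norm x ^ 2)).
{ apply Rdiv_lt_0_compat; [now apply Rmult_lt_0_compat | exact HD]. }
pose proof (norm_ge0 (tau c x)); nra.
Qed.

Lemma tau_involutive c x : disk c -> disk x -> tau c (tau c x) = x.
Proof.
intros Hc Hx.
pose proof (tau_denominator_pos c x Hc Hx) as HD.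
assert (HB : 0 < 1 - norm c ^ 2).
{ unfold disk in Hc; pose proof (norm_ge0 c); nra. }
assert (E : norm (tau c x) ^ 2 = 1 - (1 - norm c ^ 2) * (1 - norm x ^ 2)
    / (1 - 2 * dot c x + norm c ^ 2 * norm x ^ 2)).
{ rewrite <- norm_tau by assumption; ring. }
assert (E' : 1 - 2 * dot c (tau c x) + norm c ^ 2 * norm (tau c x) ^ 2
    = (1 - norm c ^ 2) ^ 2 / (1 - 2 * dot c x + norm c ^ 2 * norm x ^ 2)).
{ rewrite E; unfold tau, dot in *; cbn [fst snd].
  rewrite !norm_sq in *; field; lra. }
unfold tau at 1; rewrite E', E; clear E E'.
destruct c as [c1 c2], x as [x1 x2].
unfold tau, dot in *; rewrite !norm_sq in *; cbn [fst snd] in *.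
f_equal; field; lra.
Qed.

Lemma cos_angle p : norm p <> 0 -> norm p * cos (angle p) = fst p.
Proof.
intros Hp; pose proof (norm_ge0 p); pose proof (norm_sq p).
assert (-1 <= fst p / norm p <= 1).
{ split; [apply Rmult_le_reg_r with (norm p) | apply Rmult_le_reg_r with (norm p)];
  try lra; field_simplify; try lra; nra. }
unfold angle; destruct Rle_dec; rewrite ?cos_neg, cos_acos by lra; field; lra.
Qed.

Lemma sin_angle p : norm p <> 0 -> norm p * sin (angle p) = snd p.
Proof.
intros Hp; pose proof (norm_ge0 p); pose proof (norm_sq p) as H2.
pose proof (cos_angle p Hp) as Hc.
pose proof (sin2_cos2 (angle p)) as Hs; unfold Rsqr in Hs.
assert (Hq : Rsqr (norm p * sin (angle p)) = Rsqr (snd p)).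
{ unfold Rsqr.
  replace (norm p * sin (angle p) * (norm p * sin (angle p)))
    with (norm p ^ 2 * (sin (angle p) * sin (angle p) + cos (angle p) * cos (angle p))
          - (norm p * cos (angle p)) ^ 2) by ring.
  rewrite Hs, Hc, H2; ring. }
pose proof (acos_bound (fst p / norm p)) as Hb.
pose proof (sin_ge_0 _ (proj1 Hb) (proj2 Hb)).
revert Hq; unfold angle; destruct Rle_dec; intros Hq.
- apply Rsqr_inj; [now apply Rmult_le_pos | assumption | exact Hq].
- rewrite sin_neg in Hq |- *; apply Ropp_eq_reg.
  apply Rsqr_inj; [nra | lra | now rewrite <- !Rsqr_neg].
Qed.

Lemma tanh_hdist0 p : disk p -> tanh (hdist0 p / 2) = norm p.
Proof.
unfold disk; intros Hp; pose proof (norm_ge0 p).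
unfold tanh, sinh, cosh, hdist0.
assert (Hq : 0 < (1 + norm p) / (1 - norm p)) by (apply Rdiv_lt_0_compat; lra).
set (e := exp (ln ((1 + norm p) / (1 - norm p)) / 2)).
assert (He : e * e = (1 + norm p) / (1 - norm p)).
{ transitivity (exp (ln ((1 + norm p) / (1 - norm p)))); [| now apply exp_ln].
  unfold e; rewrite <- exp_plus; f_equal; field. }
assert (0 < e) by apply exp_pos.
rewrite exp_Ropp; fold e.
replace ((e - / e) / 2 / ((e + / e) / 2)) with ((e * e - 1) / (e * e + 1))
  by (field; repeat split; nra).
rewrite He; field; lra.
Qed.

Lemma X_polar p : disk p -> norm p <> 0 -> X (hdist0 p) (angle p) = p.
Proof.
intros Hp Hn; unfold X; rewrite tanh_hdist0, cos_angle, sin_angle by assumption.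
now destruct p.
Qed.

Lemma tanh_exp r : tanh (r / 2) = (exp r - 1) / (exp r + 1).
Proof.
unfold tanh, sinh, cosh; rewrite exp_Ropp.
replace (exp r) with (exp (r / 2) * exp (r / 2))
  by (rewrite <- exp_plus; f_equal; field).
pose proof (exp_pos (r / 2)); field; repeat split; nra.
Qed.

Lemma norm_X r theta : 0 < r -> norm (X r theta) = (exp r - 1) / (exp r + 1).
Proof.
intros Hr; rewrite <- tanh_exp; unfold norm, dot, X; cbn [fst snd].
pose proof (sin2_cos2 theta) as Hs; unfold Rsqr in Hs.
replace (tanh (r / 2) * cos theta * (tanh (r / 2) * cos theta)
         + tanh (r / 2) * sin theta * (tanh (r / 2) * sin theta))
  with (tanh (r / 2) * tanh (r / 2)
        * (sin theta * sin theta + cos theta * cos theta)) by ring.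
rewrite Hs, Rmult_1_r; apply sqrt_square.
rewrite tanh_exp; pose proof (exp_ineq1 r); left; apply Rdiv_lt_0_compat; lra.
Qed.

Lemma dilation0_X k1 k2 r theta : 0 < r ->
  dilation0 k1 k2 (X r theta) =
  X (r * sqrt (k1 ^ 2 * cos theta ^ 2 + k2 ^ 2 * sin theta ^ 2))
    (angle (k1 * cos theta, k2 * sin theta)).
Proof.
intros Hr; pose proof (norm_X r theta Hr) as Hn.
assert (He : 1 < exp r) by (pose proof (exp_ineq1 r); lra).
assert (H0 : 0 < norm (X r theta))
  by (rewrite Hn; apply Rdiv_lt_0_compat; lra).
assert (Hh : hdist0 (X r theta) = r).
{ unfold hdist0; rewrite Hn; transitivity (ln (exp r)); [| apply ln_exp].
  f_equal; field; lra. }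
unfold dilation0; destruct Req_EM_T as [H | _]; [lra |].
assert (Hn' : norm (X r theta) = tanh (r / 2)) by now rewrite tanh_exp.
assert (Hc : cos (angle (X r theta)) = cos theta).
{ apply Rmult_eq_reg_l with (norm (X r theta)); [| lra].
  rewrite cos_angle, Hn' by lra; reflexivity. }
assert (Hs : sin (angle (X r theta)) = sin theta).
{ apply Rmult_eq_reg_l with (norm (X r theta)); [| lra].
  rewrite sin_angle, Hn' by lra; reflexivity. }
now cbv zeta; rewrite Hh, Hc, Hs.
Qed.

(* Main.v *)
(* Conjugation by [tau c], a projective map in the Klein model, reduces the claim
   to [c = 0].  There geodesics are straight, and writing [A = diag(k1, k2)],
   [q(y) = |A y|], [h(y) = artanh |y| / |y|], the dilation is [y |-> A y / N(y)]
   with [N = q coth (q h)].  Radial shrinking preserves a convex set containing 0,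
   so it suffices that [N] is convex on the disk.  Deform [A] from the identity:
   along [A_t = diag(1 + t (k1 - 1), 1 + t (k2 - 1))] with [Q = q q'],
     [N' = Q / q^2 * (N - (N^2 - q^2) artanh (q / N) / q)
         = integral over T in [0, 1] of Q N (1 - T^2) / (N^2 - T^2 q^2)],
   which is jointly subadditive in [(y, N)], [Q] and [q^2] being positive
   semidefinite forms in [y].  Hence a convex combination [M] of two gauges grows
   at least at the rate required for [artanh (q / M) / q] to decrease, which is the
   comparison with the gauge at the intermediate point. *)
From Stdlib Require Import Reals Lra.
From Coquelicot Require Import Coquelicot.
Require Import Defs.
Open Scope R_scope.

(** * Convexity of the gauge *)

Lemma derive_nonneg_le (f df : R -> R) (a b : R) : a <= b ->
  (forall x, a <= x <= b -> is_derive f x (df x)) ->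
  (forall x, a <= x <= b -> 0 <= df x) -> f a <= f b.
Proof.
intros Hab Hd Hp.
destruct (MVT_gen f a b df) as [x [Hx E]].
- intros x Hx; rewrite Rmin_left, Rmax_right in Hx by lra; apply Hd; lra.
- intros x Hx; rewrite Rmin_left, Rmax_right in Hx by lra.
  apply derivable_continuous_pt; exists (df x); apply is_derive_Reals, Hd; lra.
- rewrite Rmin_left, Rmax_right in Hx by lra.
  pose proof (Rmult_le_pos _ _ (Hp x Hx) (Rge_le _ _ (Rge_minus _ _ (Rle_ge _ _ Hab)))); lra.
Qed.

Definition artanh (s : R) : R := ln ((1 + s) / (1 - s)) / 2.

Lemma is_derive_artanh s : -1 < s < 1 -> is_derive artanh s (/ (1 - s ^ 2)).
Proof.
intros Hs; unfold artanh; auto_derive.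
- split; [lra |]; split; [| easy]; apply Rdiv_lt_0_compat; lra.
- field; repeat split; nra.
Qed.

Lemma artanh_0 : artanh 0 = 0.
Proof.
unfold artanh; replace ((1 + 0) / (1 - 0)) with 1 by field; rewrite ln_1; field.
Qed.

(** Titu's form of Cauchy-Schwarz: the difference of the two sides is an explicit square over a
    positive denominator. *)
Lemma titu x1 x2 w1 w2 : 0 < w1 -> 0 < w2 ->
  (x1 + x2) ^ 2 / (w1 + w2) <= x1 ^ 2 / w1 + x2 ^ 2 / w2.
Proof.
intros H1 H2.
assert (E : x1 ^ 2 / w1 + x2 ^ 2 / w2 - (x1 + x2) ^ 2 / (w1 + w2)
  = (x1 * w2 - x2 * w1) ^ 2 / (w1 * w2 * (w1 + w2))) by (field; lra).
assert (0 <= (x1 * w2 - x2 * w1) ^ 2 / (w1 * w2 * (w1 + w2))).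
{ apply Rmult_le_pos; [apply pow2_ge_0 | left; apply Rinv_0_lt_compat;
  repeat apply Rmult_lt_0_compat; lra]. }
lra.
Qed.

Lemma titu_form a b x1 y1 x2 y2 w1 w2 : 0 <= a -> 0 <= b -> 0 < w1 -> 0 < w2 ->
  (a * (x1 + x2) ^ 2 + b * (y1 + y2) ^ 2) / (w1 + w2)
  <= (a * x1 ^ 2 + b * y1 ^ 2) / w1 + (a * x2 ^ 2 + b * y2 ^ 2) / w2.
Proof.
intros Ha Hb H1 H2.
pose proof (Rmult_le_compat_l a _ _ Ha (titu x1 x2 w1 w2 H1 H2)).
pose proof (Rmult_le_compat_l b _ _ Hb (titu y1 y2 w1 w2 H1 H2)).
unfold Rdiv in *; lra.
Qed.

(* The common growth rate of the gauges below, as a function of [q], [N] and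
   [Q = q * q']; it is the integral of [Q * N * (1 - T^2) / (N^2 - T^2 * q^2)]
   over [T] in [[0, 1]]. *)
Definition rate (Q q N : R) : R :=
  Q / q ^ 2 * (N - (N ^ 2 - q ^ 2) * (artanh (q / N) / q)).

(** The same integral stopped at [T], in closed form: comparing integrals becomes a monotonicity
    statement in [T], and no integral has to be formed. *)
Definition partial_rate (Q q N T : R) : R :=
  Q / q ^ 2 * (N * T - (N ^ 2 - q ^ 2) * (artanh (T * q / N) / q)).

Lemma is_derive_partial_rate Q q N T : 0 < q < N -> 0 <= T <= 1 ->
  is_derive (partial_rate Q q N) T (Q * (1 - T ^ 2) / (N - T ^ 2 * q ^ 2 / N)).
Proof.
intros Hq HT; unfold partial_rate.
assert (Hs : -1 < T * q / N < 1).
{ split; apply Rmult_lt_reg_r with N; try lra; field_simplify; nra. }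
pose proof (is_derive_artanh _ Hs) as Hd.
assert (0 < N ^ 2 - T ^ 2 * q ^ 2).
{ replace (N ^ 2 - T ^ 2 * q ^ 2) with ((N - T * q) * (N + T * q)) by ring.
  apply Rmult_lt_0_compat; nra. }
auto_derive.
- eexists; apply Hd.
- match goal with |- context [Derive ?g ?z] =>
    replace (Derive g z) with (/ (1 - (T * q / N) ^ 2))
      by (symmetry; apply is_derive_unique, Hd) end.
  field; repeat split; try lra; nra.
Qed.

(** The integrands are compared for each [T]. Written as [Q (1 - T^2) / (N - T^2 q^2 / N)], they
    have superadditive denominators by [titu_form]; a second use of it, on [Q] over these
    denominators, gives subadditivity. *)
Lemma rate_subadditive a b c d x1 y1 x2 y2 q1 q2 q N1 N2 :
  0 <= a -> 0 <= b -> 0 <= c -> 0 <= d ->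
  q1 ^ 2 = c * x1 ^ 2 + d * y1 ^ 2 -> q2 ^ 2 = c * x2 ^ 2 + d * y2 ^ 2 ->
  q ^ 2 = c * (x1 + x2) ^ 2 + d * (y1 + y2) ^ 2 ->
  0 < q1 < N1 -> 0 < q2 < N2 -> 0 < q ->
  q < N1 + N2 /\
  rate (a * (x1 + x2) ^ 2 + b * (y1 + y2) ^ 2) q (N1 + N2)
  <= rate (a * x1 ^ 2 + b * y1 ^ 2) q1 N1 + rate (a * x2 ^ 2 + b * y2 ^ 2) q2 N2.
Proof.
intros Ha Hb Hc Hd E1 E2 E H1 H2 Hq.
pose proof (titu_form c d x1 y1 x2 y2 N1 N2 Hc Hd ltac:(lra) ltac:(lra)) as HT.
rewrite <- E, <- E1, <- E2 in HT.
assert (W1 : forall T, 0 <= T <= 1 -> 0 < N1 - T ^ 2 * q1 ^ 2 / N1).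
{ intros T HT'. replace (N1 - T ^ 2 * q1 ^ 2 / N1)
    with ((N1 - T * q1) * (N1 + T * q1) / N1) by (field; lra).
  apply Rdiv_lt_0_compat; [apply Rmult_lt_0_compat |]; nra. }
assert (W2 : forall T, 0 <= T <= 1 -> 0 < N2 - T ^ 2 * q2 ^ 2 / N2).
{ intros T HT'. replace (N2 - T ^ 2 * q2 ^ 2 / N2)
    with ((N2 - T * q2) * (N2 + T * q2) / N2) by (field; lra).
  apply Rdiv_lt_0_compat; [apply Rmult_lt_0_compat |]; nra. }
assert (W : forall T, 0 <= T <= 1 ->
  (N1 - T ^ 2 * q1 ^ 2 / N1) + (N2 - T ^ 2 * q2 ^ 2 / N2)
  <= (N1 + N2) - T ^ 2 * q ^ 2 / (N1 + N2)).
{ intros T HT'.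
  pose proof (Rmult_le_compat_l (T ^ 2) _ _ (pow2_ge_0 T) HT).
  unfold Rdiv in *; lra. }
(* Superadditivity of the denominators at [T = 1] already forces [q^2 < (N1 + N2)^2]. *)
assert (Hlt : q < N1 + N2).
{ pose proof (W 1 ltac:(lra)); pose proof (W1 1 ltac:(lra)); pose proof (W2 1 ltac:(lra)).
  assert (H' : 0 < ((N1 + N2) - 1 ^ 2 * q ^ 2 / (N1 + N2)) * (N1 + N2))
    by (apply Rmult_lt_0_compat; lra).
  field_simplify in H'; nra. }
split; [exact Hlt |].
set (Q := a * (x1 + x2) ^ 2 + b * (y1 + y2) ^ 2).
set (Q1 := a * x1 ^ 2 + b * y1 ^ 2).
set (Q2 := a * x2 ^ 2 + b * y2 ^ 2).
(* The defect of subadditivity up to [T]: it vanishes at 0 and has to be nonnegative at 1. *)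
pose (f := fun T => (partial_rate Q1 q1 N1 T + partial_rate Q2 q2 N2 T)
                    - partial_rate Q q (N1 + N2) T).
assert (Hf : f 0 <= f 1).
{ apply (derive_nonneg_le f (fun T =>
    (Q1 * (1 - T ^ 2) / (N1 - T ^ 2 * q1 ^ 2 / N1)
     + Q2 * (1 - T ^ 2) / (N2 - T ^ 2 * q2 ^ 2 / N2))
    - Q * (1 - T ^ 2) / ((N1 + N2) - T ^ 2 * q ^ 2 / (N1 + N2)))); [lra | |].
  - intros T HT'; unfold f.
    apply @is_derive_minus; [apply @is_derive_plus |]; now apply is_derive_partial_rate.
  - intros T HT'.
    specialize (W T HT'); specialize (W1 T HT'); specialize (W2 T HT').
    pose proof (titu_form a b x1 y1 x2 y2 _ _ Ha Hb W1 W2) as HQ.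
    fold Q Q1 Q2 in HQ.
    assert (0 <= Q) by (unfold Q; pose proof (pow2_ge_0 (x1 + x2)); pose proof (pow2_ge_0 (y1 + y2)); nra).
    pose proof (Rmult_le_compat_l Q _ _ H (Rinv_le_contravar _ _ (Rplus_lt_0_compat _ _ W1 W2) W)) as HI.
    assert (0 <= 1 - T ^ 2) by nra.
    assert (HF : Q / (N1 + N2 - T ^ 2 * q ^ 2 / (N1 + N2))
      <= Q1 / (N1 - T ^ 2 * q1 ^ 2 / N1) + Q2 / (N2 - T ^ 2 * q2 ^ 2 / N2))
      by (unfold Rdiv in *; lra).
    pose proof (Rmult_le_compat_l _ _ _ H0 HF).
    unfold Rdiv in *; lra. }
assert (P0 : forall Q' q' N', partial_rate Q' q' N' 0 = 0).
{ intros; unfold partial_rate; replace (0 * q' / N') with 0 by (unfold Rdiv; ring).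
  rewrite artanh_0; unfold Rdiv; ring. }
assert (P1 : forall Q' q' N', partial_rate Q' q' N' 1 = rate Q' q' N').
{ intros; unfold partial_rate, rate; now rewrite Rmult_1_l, Rmult_1_r. }
unfold f in Hf; rewrite !P0, !P1 in Hf; lra.
Qed.

(** * The gauge and its growth along the deformation *)

(** This is [q coth (q h)], the value of [N] for which [artanh (q / N) / q = h]. *)
Definition gauge (h q : R) : R := q * (exp (2 * (q * h)) + 1) / (exp (2 * (q * h)) - 1).

Lemma exp_gt_1 x : 0 < x -> 1 < exp x.
Proof. intros Hx; rewrite <- exp_0; now apply exp_increasing. Qed.

Lemma gauge_gt h q : 0 < h -> 0 < q -> q < gauge h q.
Proof.
intros Hh Hq; unfold gauge.
pose proof (exp_gt_1 (2 * (q * h)) ltac:(nra)).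
apply Rmult_lt_reg_r with (exp (2 * (q * h)) - 1); [lra |].
field_simplify; nra.
Qed.

Lemma artanh_gauge h q : 0 < h -> 0 < q -> artanh (q / gauge h q) = q * h.
Proof.
intros Hh Hq; unfold artanh, gauge.
pose proof (exp_gt_1 (2 * (q * h)) ltac:(nra)).
set (e := exp (2 * (q * h))) in *.
replace ((1 + q / (q * (e + 1) / (e - 1))) / (1 - q / (q * (e + 1) / (e - 1)))) with e
  by (field; repeat split; nra).
unfold e; rewrite ln_exp; field.
Qed.

(** Since [h = artanh (q / N) / q], it can be eliminated from the derivative, leaving an expression
    in [q] and [N] alone. The extra factor [q] cancels against [q' = Q / q] in the chain rule. *)
Lemma is_derive_gauge h q : 0 < h -> 0 < q ->
  is_derive (gauge h) q (rate 1 q (gauge h q) * q).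
Proof.
intros Hh Hq; unfold rate; rewrite artanh_gauge by easy.
unfold gauge; pose proof (exp_gt_1 (2 * (q * h)) ltac:(nra)).
auto_derive; [lra |].
set (e := exp (2 * (q * h))) in *.
field; lra.
Qed.


Definition stretched_norm (k1 k2 x y : R) : R := sqrt ((k1 * x) ^ 2 + (k2 * y) ^ 2).

Lemma stretched_norm_sq k1 k2 x y :
  stretched_norm k1 k2 x y ^ 2 = k1 ^ 2 * x ^ 2 + k2 ^ 2 * y ^ 2.
Proof. unfold stretched_norm; rewrite pow2_sqrt; nra. Qed.

Lemma stretched_sq_pos k1 k2 x y : 1 <= k1 -> 1 <= k2 -> 0 < x ^ 2 + y ^ 2 ->
  0 < (k1 * x) ^ 2 + (k2 * y) ^ 2.
Proof.
intros H1 H2 H.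
assert (0 <= (k1 ^ 2 - 1) * x ^ 2) by (apply Rmult_le_pos; [nra | apply pow2_ge_0]).
assert (0 <= (k2 ^ 2 - 1) * y ^ 2) by (apply Rmult_le_pos; [nra | apply pow2_ge_0]).
nra.
Qed.

Lemma stretched_norm_pos k1 k2 x y : 1 <= k1 -> 1 <= k2 -> 0 < x ^ 2 + y ^ 2 ->
  0 < stretched_norm k1 k2 x y.
Proof. intros; now apply sqrt_lt_R0, stretched_sq_pos. Qed.

Lemma rate_scal Q q N : rate Q q N = Q * rate 1 q N.
Proof. unfold rate, Rdiv; ring. Qed.

(* The weights of a convex combination are absorbed by homogeneity:
   [l * gauge h q = gauge (h / l) (l * q)]. *)
Lemma gauge_sum_flow k1 k2 h1 h2 x1 y1 x2 y2 :
  1 <= k1 -> 1 <= k2 -> 0 < h1 -> 0 < h2 ->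
  0 < x1 ^ 2 + y1 ^ 2 -> 0 < x2 ^ 2 + y2 ^ 2 -> 0 < (x1 + x2) ^ 2 + (y1 + y2) ^ 2 ->
  let psi l1 l2 :=
    let q := stretched_norm l1 l2 (x1 + x2) (y1 + y2) in
    artanh (q / (gauge h1 (stretched_norm l1 l2 x1 y1)
                 + gauge h2 (stretched_norm l1 l2 x2 y2))) / q in
  psi k1 k2 <= psi 1 1.
Proof.
intros Hk1 Hk2 Hh1 Hh2 P1 P2 P psi.
(* The path of diagonal matrices from the identity at [t = 0] to [diag(k1, k2)] at [t = 1]. *)
pose (l1 := fun t => 1 + t * (k1 - 1)).
pose (l2 := fun t => 1 + t * (k2 - 1)).
pose (q := fun x y t => stretched_norm (l1 t) (l2 t) x y).
(* [Q = q q'], half the derivative of [q^2]; its coefficients are nonnegative because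
   [k1, k2 >= 1]. *)
pose (Q := fun x y t => l1 t * (k1 - 1) * x ^ 2 + l2 t * (k2 - 1) * y ^ 2).
assert (L1 : forall t, 0 <= t <= 1 -> 1 <= l1 t) by (intros; unfold l1; nra).
assert (L2 : forall t, 0 <= t <= 1 -> 1 <= l2 t) by (intros; unfold l2; nra).
assert (qpos : forall x y t, 0 <= t <= 1 -> 0 < x ^ 2 + y ^ 2 -> 0 < q x y t)
  by (intros; apply stretched_norm_pos; auto).
assert (dq : forall x y t, 0 <= t <= 1 -> 0 < x ^ 2 + y ^ 2 ->
  is_derive (q x y) t (Q x y t / q x y t)).
{ intros x y t Ht Hxy.
  pose proof (qpos x y t Ht Hxy) as Hq.
  unfold q, stretched_norm in Hq |- *; unfold Q, l1, l2 in *.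
  auto_derive.
  - apply stretched_sq_pos; auto.
  - set (s := sqrt (((1 + t * (k1 - 1)) * x) ^ 2 + _)) in *.
    match goal with |- context [sqrt ?a] =>
      replace (sqrt a) with s by (unfold s; f_equal; ring) end.
    field; lra. }
pose (M := fun t => gauge h1 (q x1 y1 t) + gauge h2 (q x2 y2 t)).
pose (M' := fun t => rate (Q x1 y1 t) (q x1 y1 t) (gauge h1 (q x1 y1 t))
                     + rate (Q x2 y2 t) (q x2 y2 t) (gauge h2 (q x2 y2 t))).
assert (dN : forall h x y t, 0 < h -> 0 <= t <= 1 -> 0 < x ^ 2 + y ^ 2 ->
  is_derive (fun t => gauge h (q x y t)) t (rate (Q x y t) (q x y t) (gauge h (q x y t)))).
{ intros h x y t Hh Ht Hxy.
  pose proof (qpos x y t Ht Hxy) as Hq.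
  rewrite rate_scal.
  replace (Q x y t * rate 1 (q x y t) (gauge h (q x y t)))
    with (Q x y t / q x y t * (rate 1 (q x y t) (gauge h (q x y t)) * q x y t))
    by (field; lra).
  apply (is_derive_comp (gauge h) (q x y)); [now apply is_derive_gauge | now apply dq]. }
assert (dM : forall t, 0 <= t <= 1 -> is_derive M t (M' t)).
{ intros t Ht; apply @is_derive_plus; now apply dN. }
pose (p := q (x1 + x2) (y1 + y2)).
pose (S := Q (x1 + x2) (y1 + y2)).
assert (HR : forall t, 0 <= t <= 1 -> 0 < p t < M t /\ rate (S t) (p t) (M t) <= M' t).
{ intros t Ht.
  assert (Hp : 0 < p t) by now apply qpos.
  pose proof (L1 t Ht); pose proof (L2 t Ht).
  destruct (rate_subadditive (l1 t * (k1 - 1)) (l2 t * (k2 - 1)) (l1 t ^ 2) (l2 t ^ 2)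
    x1 y1 x2 y2 (q x1 y1 t) (q x2 y2 t) (p t) (gauge h1 (q x1 y1 t)) (gauge h2 (q x2 y2 t)))
    as [A B]; try apply pow2_ge_0; try (apply Rmult_le_pos; lra);
    try apply stretched_norm_sq; try easy;
    try (split; [now apply qpos | apply gauge_gt; [easy | now apply qpos]]).  }
(* The sign makes [f] nondecreasing: its derivative is [M' - rate S p M] divided by the positive
   [M^2 - p^2]. *)
pose (f := fun t => - (artanh (p t / M t) / p t)).
assert (Hf : f 0 <= f 1).
{ apply (derive_nonneg_le f (fun t => (M' t - rate (S t) (p t) (M t)) / (M t ^ 2 - p t ^ 2)));
    [lra | |].
  - intros t Ht; destruct (HR t Ht) as [Hp _].
    assert (Hs : -1 < p t / M t < 1).
    { split; apply Rmult_lt_reg_r with (M t); try lra; field_simplify; nra. }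
    pose proof (is_derive_artanh _ Hs) as Hd.
    pose proof (dq (x1 + x2) (y1 + y2) t Ht P) as Hdp; fold p S in Hdp.
    pose proof (dM t Ht) as HdM.
    unfold f; auto_derive.
    + repeat split; try (eexists; eassumption); lra.
    + match goal with |- context [Derive ?g (p t * / M t)] =>
        replace (Derive g (p t * / M t)) with (/ (1 - (p t / M t) ^ 2))
          by (symmetry; apply is_derive_unique, Hd) end.
      replace (Derive (fun x => p x) t) with (S t / p t)
        by (symmetry; apply is_derive_unique, Hdp).
      replace (Derive (fun x => M x) t) with (M' t)
        by (symmetry; apply is_derive_unique, HdM).
      unfold rate, Rdiv; field; repeat split; nra.
  - intros t Ht; destruct (HR t Ht) as [Hp Hr].
    apply Rmult_le_pos; [lra | left; apply Rinv_0_lt_compat; nra]. }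
assert (E : forall t, psi (l1 t) (l2 t) = - f t).
{ intros t; unfold psi, f, p, M, q; cbv zeta; ring. }
replace k1 with (l1 1) by (unfold l1; ring).
replace k2 with (l2 1) by (unfold l2; ring).
assert (E0 : psi 1 1 = - f 0).
{ rewrite <- E; unfold l1, l2; f_equal; ring. }
rewrite E0, E; lra.
Qed.

(** * The Klein model *)

Definition klein (p : point) : point :=
  (2 * fst p / (1 + (fst p ^ 2 + snd p ^ 2)), 2 * snd p / (1 + (fst p ^ 2 + snd p ^ 2))).

Definition between (u v w : point) : Prop :=
  exists mu, 0 <= mu <= 1 /\ fst w = (1 - mu) * fst u + mu * fst v /\
    snd w = (1 - mu) * snd u + mu * snd v.

Lemma disk_sq p : disk p <-> fst p ^ 2 + snd p ^ 2 < 1.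
Proof.
unfold disk; rewrite <- norm_sq; pose proof (norm_ge0 p); split; nra.
Qed.

Lemma norm_eq_of_sq p r : 0 <= r -> fst p ^ 2 + snd p ^ 2 = r ^ 2 -> norm p = r.
Proof.
intros Hr E; pose proof (norm_ge0 p); pose proof (norm_sq p).
apply Rsqr_inj; unfold Rsqr; lra.
Qed.

(** Comparing squared norms gives [(s - s') (1 - s s') = 0]; in the disk the second factor is
    positive, so the denominators agree. *)
Lemma klein_inj p q : disk p -> disk q -> klein p = klein q -> p = q.
Proof.
rewrite !disk_sq; destruct p as [p1 p2], q as [q1 q2]; unfold klein; cbn [fst snd].
set (s := p1 ^ 2 + p2 ^ 2); set (s' := q1 ^ 2 + q2 ^ 2); intros Hs Hs' E.
injection E as E1 E2.
assert (0 <= s) by (unfold s; nra); assert (0 <= s') by (unfold s'; nra).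
assert (F1 : p1 * (1 + s') = q1 * (1 + s)).
{ replace (p1 * (1 + s')) with (2 * p1 / (1 + s) * ((1 + s) * (1 + s') / 2)) by (field; lra).
  rewrite E1; field; lra. }
assert (F2 : p2 * (1 + s') = q2 * (1 + s)).
{ replace (p2 * (1 + s')) with (2 * p2 / (1 + s) * ((1 + s) * (1 + s') / 2)) by (field; lra).
  rewrite E2; field; lra. }
assert (F : (s - s') * (1 - s * s') = 0).
{ assert (s * (1 + s') ^ 2 = s' * (1 + s) ^ 2).
  { transitivity ((p1 * (1 + s')) ^ 2 + (p2 * (1 + s')) ^ 2); [unfold s; ring |].
    rewrite F1, F2; unfold s'; ring. }
  nra. }
assert (Es : s = s') by (apply Rmult_integral in F; destruct F; nra).
rewrite Es in F1, F2; f_equal; apply Rmult_eq_reg_r with (1 + s'); lra.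
Qed.

Lemma between_on_line (P d : point) (s1 s2 s : R) u v w :
  s1 <= s <= s2 \/ s2 <= s <= s1 ->
  u = (fst P + s1 * fst d, snd P + s1 * snd d) ->
  v = (fst P + s2 * fst d, snd P + s2 * snd d) ->
  w = (fst P + s * fst d, snd P + s * snd d) ->
  between u v w.
Proof.
intros Hs -> -> ->; unfold between; cbn [fst snd].
destruct (Req_dec s1 s2) as [-> | Hn].
- exists 0; replace s with s2 by lra; repeat split; try lra; ring.
- exists ((s - s1) / (s2 - s1)).
  assert (s2 - s1 <> 0) by lra.
  assert (E : (s - s1) / (s2 - s1) * (s2 - s1) = s - s1) by (field; lra).
  repeat split; try (field; lra); destruct Hs; nra.
Qed.

(** * Orthogonal circles and diameters in Klein coordinates *)

(** Pythagoras in the right triangle formed by 0, [m] and a common point of the two circles. *)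
Lemma orthogonal_radius m rho : orthogonal_to_unit_circle m rho ->
  fst m ^ 2 + snd m ^ 2 = 1 + rho ^ 2.
Proof.
intros [[p [H1 H2]] H].
specialize (H p H1 H2).
pose proof (norm_sq p) as N1; pose proof (norm_sq (psub p m)) as N2.
rewrite H1 in N1; rewrite H2 in N2; unfold dot, psub in *; cbn [fst snd] in *; nra.
Qed.

Definition circle_point (m : point) (rho t : R) : point :=
  (fst m + rho * cos t, snd m + rho * sin t).

(* The Klein model straightens an orthogonal circle of centre [m] into the
   line [{x | m . x = 1}], on which this is an affine coordinate. *)
Definition chord_coord (m : point) (rho t : R) : R :=
  (fst m * sin t - snd m * cos t)
  / (1 + rho ^ 2 + rho * (fst m * cos t + snd m * sin t)).

Lemma cos2_sin2 t : cos t ^ 2 + sin t ^ 2 = 1.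
Proof. pose proof (sin2_cos2 t) as H; unfold Rsqr in H; lra. Qed.

Lemma circle_point_sq m rho t : fst m ^ 2 + snd m ^ 2 = 1 + rho ^ 2 ->
  1 + (fst (circle_point m rho t) ^ 2 + snd (circle_point m rho t) ^ 2)
  = 2 * (1 + rho ^ 2 + rho * (fst m * cos t + snd m * sin t)).
Proof.
intros Hm; unfold circle_point; cbn [fst snd].
pose proof (cos2_sin2 t).
replace (1 + ((fst m + rho * cos t) ^ 2 + (snd m + rho * sin t) ^ 2)) with
  (1 + (fst m ^ 2 + snd m ^ 2) + rho ^ 2 * (cos t ^ 2 + sin t ^ 2)
   + 2 * rho * (fst m * cos t + snd m * sin t)) by ring.
rewrite Hm, H; ring.
Qed.

Lemma chord_denominator_pos m rho t : fst m ^ 2 + snd m ^ 2 = 1 + rho ^ 2 ->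
  0 < 1 + rho ^ 2 + rho * (fst m * cos t + snd m * sin t).
Proof.
intros Hm; pose proof (circle_point_sq m rho t Hm).
pose proof (pow2_ge_0 (fst (circle_point m rho t))).
pose proof (pow2_ge_0 (snd (circle_point m rho t))); lra.
Qed.

Lemma circle_point_disk m rho t : 0 < rho -> fst m ^ 2 + snd m ^ 2 = 1 + rho ^ 2 ->
  disk (circle_point m rho t) <-> fst m * cos t + snd m * sin t < - rho.
Proof.
intros Hr Hm; rewrite disk_sq; pose proof (circle_point_sq m rho t Hm).
split; intros; nra.
Qed.

Lemma klein_circle m rho t : fst m ^ 2 + snd m ^ 2 = 1 + rho ^ 2 ->
  klein (circle_point m rho t) =
  (fst m / (1 + rho ^ 2) + chord_coord m rho t * (- rho * snd m / (1 + rho ^ 2)),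
   snd m / (1 + rho ^ 2) + chord_coord m rho t * (rho * fst m / (1 + rho ^ 2))).
Proof.
intros Hm; unfold klein; rewrite circle_point_sq by assumption.
pose proof (chord_denominator_pos m rho t Hm) as HD.
unfold chord_coord, circle_point; cbn [fst snd].
assert (0 < 1 + rho ^ 2) by nra.
pose proof (cos2_sin2 t) as E.
set (D := 1 + rho ^ 2 + rho * (fst m * cos t + snd m * sin t)) in *.
f_equal.
- apply Rmult_eq_reg_r with ((1 + rho ^ 2) * D); [| apply Rgt_not_eq; nra].
  replace (2 * (fst m + rho * cos t) / (2 * D) * ((1 + rho ^ 2) * D))
    with ((fst m + rho * cos t) * (1 + rho ^ 2)) by (field; lra).
  transitivity (fst m * D - rho * snd m * (fst m * sin t - snd m * cos t)); [| field; lra].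
  unfold D; rewrite <- Hm; ring.
- apply Rmult_eq_reg_r with ((1 + rho ^ 2) * D); [| apply Rgt_not_eq; nra].
  replace (2 * (snd m + rho * sin t) / (2 * D) * ((1 + rho ^ 2) * D))
    with ((snd m + rho * sin t) * (1 + rho ^ 2)) by (field; lra).
  transitivity (snd m * D + rho * fst m * (fst m * sin t - snd m * cos t)); [| field; lra].
  unfold D; rewrite <- Hm; ring.
Qed.

Lemma is_derive_chord_coord m rho t : fst m ^ 2 + snd m ^ 2 = 1 + rho ^ 2 ->
  is_derive (chord_coord m rho) t
    ((1 + rho ^ 2) * (fst m * cos t + snd m * sin t + rho)
     / (1 + rho ^ 2 + rho * (fst m * cos t + snd m * sin t)) ^ 2).
Proof.
intros Hm; pose proof (chord_denominator_pos m rho t Hm) as HD.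
unfold chord_coord; auto_derive; [lra |].
set (D := 1 + rho ^ 2 + rho * (fst m * cos t + snd m * sin t)) in *.
change (rho * (rho * 1)) with (rho ^ 2); fold D.
apply Rmult_eq_reg_r with (D ^ 2); [| apply Rgt_not_eq; nra].
field_simplify; try lra.
pose proof (cos2_sin2 t) as E.
assert (E2 : (fst m * cos t + snd m * sin t) ^ 2 + (fst m * sin t - snd m * cos t) ^ 2
  = 1 + rho ^ 2).
{ rewrite <- Hm; transitivity ((fst m ^ 2 + snd m ^ 2) * (cos t ^ 2 + sin t ^ 2)); [ring |].
  rewrite E; ring. }
transitivity (rho * ((fst m * cos t + snd m * sin t) ^ 2
  + (fst m * sin t - snd m * cos t) ^ 2) + (fst m * cos t + snd m * sin t) * (1 + rho ^ 2));
  [unfold D; ring | rewrite E2; ring].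
Qed.

(** By [circle_point_disk], lying in the disk is exactly the sign condition on the derivative, so
    the coordinate is monotone along an arc that stays inside. *)
Lemma chord_coord_decreasing m rho a b : 0 < rho ->
  fst m ^ 2 + snd m ^ 2 = 1 + rho ^ 2 -> a <= b ->
  (forall t, a <= t <= b -> disk (circle_point m rho t)) ->
  chord_coord m rho b <= chord_coord m rho a.
Proof.
intros Hr Hm Hab Hdisk.
apply Ropp_le_cancel.
apply (derive_nonneg_le (fun t => - chord_coord m rho t) (fun t => - ((1 + rho ^ 2) *
  (fst m * cos t + snd m * sin t + rho)
  / (1 + rho ^ 2 + rho * (fst m * cos t + snd m * sin t)) ^ 2))); [easy | |].
- intros t _; apply @is_derive_opp; now apply is_derive_chord_coord.
- intros t Ht; specialize (Hdisk t Ht); apply circle_point_disk in Hdisk; try easy.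
  pose proof (chord_denominator_pos m rho t Hm).
  set (D := 1 + rho ^ 2 + _) in *; unfold Rdiv.
  rewrite Ropp_mult_distr_l; apply Rmult_le_pos; [nra |].
  left; apply Rinv_0_lt_compat; nra.
Qed.

Lemma Rmin_Rmax_cases a b t : Rmin a b <= t <= Rmax a b -> a <= t <= b \/ b <= t <= a.
Proof. unfold Rmin, Rmax; destruct Rle_dec; lra. Qed.

Lemma cases_Rmin_Rmax a b t : a <= t <= b \/ b <= t <= a -> Rmin a b <= t <= Rmax a b.
Proof. unfold Rmin, Rmax; destruct Rle_dec; lra. Qed.

(** [2 t / (1 + t^2)] is the Klein coordinate along a diameter; the difference of two values is
    [(b - a) (1 - a b)] times a positive factor. *)
Lemma diameter_coord_le a b : -1 < a < 1 -> -1 < b < 1 ->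
  2 * a / (1 + a ^ 2) <= 2 * b / (1 + b ^ 2) <-> a <= b.
Proof.
intros Ha Hb.
assert (E : 2 * b / (1 + b ^ 2) - 2 * a / (1 + a ^ 2)
  = (b - a) * (2 * (1 - a * b) / ((1 + a ^ 2) * (1 + b ^ 2)))) by (field; nra).
assert (0 < 2 * (1 - a * b) / ((1 + a ^ 2) * (1 + b ^ 2)))
  by (apply Rdiv_lt_0_compat; nra).
split; nra.
Qed.

Lemma diameter_sq alpha t : (t * cos alpha) ^ 2 + (t * sin alpha) ^ 2 = t ^ 2.
Proof.
transitivity (t ^ 2 * (cos alpha ^ 2 + sin alpha ^ 2)); [ring |].
rewrite cos2_sin2; ring.
Qed.

Lemma klein_diameter alpha t :
  klein (t * cos alpha, t * sin alpha)
  = (2 * t / (1 + t ^ 2) * cos alpha, 2 * t / (1 + t ^ 2) * sin alpha).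
Proof.
unfold klein; cbn [fst snd]; rewrite diameter_sq; f_equal; field; nra.
Qed.

Lemma diameter_disk alpha t : disk (t * cos alpha, t * sin alpha) <-> -1 < t < 1.
Proof. rewrite disk_sq; cbn [fst snd]; rewrite diameter_sq; split; nra. Qed.

(** Either carrier becomes a line on which the arc has a monotone affine coordinate, so the order of
    the parameters is the order of the points up to reversal. *)
Lemma segment_klein_between u v w : segment u v w ->
  disk w /\ between (klein u) (klein v) (klein w).
Proof.
intros [gamma [a [b [Hg [Ea [Eb [Hd [t [Ht ->]]]]]]]]].
split; [now apply Hd |]; subst u v.
assert (Hsub : forall s, a <= s <= t \/ t <= s <= a \/ t <= s <= b \/ b <= s <= t ->
  disk (gamma s)).
{ intros s Hs; apply Hd, cases_Rmin_Rmax; apply Rmin_Rmax_cases in Ht; lra. }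
apply Rmin_Rmax_cases in Ht.
destruct Hg as [[m [rho [Hr [Ho Hg]]]] | [alpha Hg]].
- apply orthogonal_radius in Ho.
  assert (Hc : forall s, gamma s = circle_point m rho s) by exact Hg.
  rewrite !Hc, !klein_circle by easy.
  eapply between_on_line with
    (P := (fst m / (1 + rho ^ 2), snd m / (1 + rho ^ 2)))
    (d := (- rho * snd m / (1 + rho ^ 2), rho * fst m / (1 + rho ^ 2)));
    [| reflexivity ..].
  (* [chord_coord] decreases, hence the two orders are exchanged. *)
  destruct Ht as [Ht | Ht]; [right | left]; split;
    apply chord_coord_decreasing; try easy; intros s Hs; rewrite <- Hc; apply Hsub; lra.
- assert (H1 : forall s, a <= s <= t \/ t <= s <= a \/ t <= s <= b \/ b <= s <= t -> -1 < s < 1)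
    by (intros s Hs; apply (diameter_disk alpha); rewrite <- Hg; now apply Hsub).
  rewrite !Hg, !klein_diameter.
  eapply between_on_line with (P := origin) (d := (cos alpha, sin alpha))
    (s1 := 2 * a / (1 + a ^ 2)) (s2 := 2 * b / (1 + b ^ 2)) (s := 2 * t / (1 + t ^ 2));
    [| cbn; f_equal; ring ..].
  destruct Ht as [Ht | Ht]; [left | right]; split;
    apply diameter_coord_le; try easy; apply H1; lra.
Qed.

(** * From Klein chords back to geodesic segments *)

Lemma convex_combination_cases a b mu : 0 <= mu <= 1 ->
  a <= (1 - mu) * a + mu * b <= b \/ b <= (1 - mu) * a + mu * b <= a.
Proof.
intros Hmu; destruct (Rle_dec a b); [left | right]; nra.
Qed.

Lemma polar_form p : exists r alpha, p = (r * cos alpha, r * sin alpha) /\ r = norm p.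
Proof.
destruct (Req_dec (norm p) 0) as [H | H].
- exists 0, 0; split; [| easy].
  pose proof (norm_sq p) as E; rewrite H in E; destruct p as [x y]; cbn [fst snd] in E.
  f_equal; rewrite Rmult_0_l; nra.
- exists (norm p), (angle p); split; [| easy].
  rewrite cos_angle, sin_angle by easy; now destruct p.
Qed.

(** The direction is that of [u], or that of [v] when [u] is the origin; [b] may be negative, which
    covers points on opposite sides of the origin. *)
Lemma common_diameter u v : fst u * snd v = snd u * fst v ->
  exists alpha a b, u = (a * cos alpha, a * sin alpha) /\ v = (b * cos alpha, b * sin alpha).
Proof.
intros E.
destruct (polar_form u) as [r [alpha [Hu Hr]]].
destruct (Req_dec r 0) as [-> | H].
- destruct (polar_form v) as [r' [beta [Hv _]]].
  exists beta, 0, r'; split; [| easy]; rewrite Hu; f_equal; ring.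
- exists alpha, r, (fst v * cos alpha + snd v * sin alpha); split; [easy |].
  rewrite Hu in E; cbn [fst snd] in E.
  assert (E' : cos alpha * snd v = sin alpha * fst v)
    by (apply Rmult_eq_reg_l with r; lra).
  pose proof (cos2_sin2 alpha) as E1.
  destruct v as [x y]; cbn [fst snd] in *; f_equal.
  + transitivity (x * (cos alpha ^ 2 + sin alpha ^ 2)); [rewrite E1; ring |].
    transitivity (x * cos alpha ^ 2 + sin alpha * (sin alpha * x)); [ring |].
    rewrite <- E'; ring.
  + transitivity (y * (cos alpha ^ 2 + sin alpha ^ 2)); [rewrite E1; ring |].
    transitivity (y * sin alpha ^ 2 + cos alpha * (cos alpha * y)); [ring |].
    rewrite E'; ring.
Qed.

Lemma diameter_segment u v w : disk u -> disk v -> disk w ->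
  fst u * snd v = snd u * fst v -> between (klein u) (klein v) (klein w) ->
  segment u v w.
Proof.
intros Hu Hv Hw Huv Hb.
destruct (common_diameter u v Huv) as [alpha [a [b [-> ->]]]].
destruct Hb as [mu [Hmu [E1 E2]]]; rewrite !klein_diameter in E1, E2; cbn [fst snd] in E1, E2.
set (k := (1 - mu) * (2 * a / (1 + a ^ 2)) + mu * (2 * b / (1 + b ^ 2))).
(* [w] is [klein w] scaled by [(1 + |w|^2) / 2], and [k] is the coordinate of [klein w] along the
   diameter. *)
pose (c := (1 + (fst w ^ 2 + snd w ^ 2)) / 2 * k).
assert (Ew : w = (c * cos alpha, c * sin alpha)).
{ unfold klein in E1, E2; cbn [fst snd] in E1, E2.
  rewrite (surjective_pairing w) at 1; unfold c; f_equal.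
  - transitivity ((1 + (fst w ^ 2 + snd w ^ 2)) / 2
      * (2 * fst w / (1 + (fst w ^ 2 + snd w ^ 2)))); [field; nra |].
    rewrite E1; unfold k; ring.
  - transitivity ((1 + (fst w ^ 2 + snd w ^ 2)) / 2
      * (2 * snd w / (1 + (fst w ^ 2 + snd w ^ 2)))); [field; nra |].
    rewrite E2; unfold k; ring. }
assert (Ek : 2 * c / (1 + c ^ 2) = k).
{ replace (c ^ 2) with (fst w ^ 2 + snd w ^ 2)
    by (rewrite Ew at 1 2; cbn [fst snd]; apply diameter_sq).
  unfold c; field; nra. }
clearbody c; subst w; rewrite diameter_disk in Hu, Hv, Hw.
exists (fun t => (t * cos alpha, t * sin alpha)), a, b.
split; [right; now exists alpha |]; repeat split; try easy.
- intros t Ht; apply diameter_disk; apply Rmin_Rmax_cases in Ht; lra.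
- exists c; split; [| easy]; apply cases_Rmin_Rmax.
  rewrite <- (diameter_coord_le a c), <- (diameter_coord_le c b),
    <- (diameter_coord_le b c), <- (diameter_coord_le c a), Ek by easy.
  now apply convex_combination_cases.
Qed.

(* [psi] is the angle, seen from the centre [m], between [p] and the origin. *)
Lemma circle_point_polar m rho beta p : 0 < rho ->
  fst m ^ 2 + snd m ^ 2 = 1 + rho ^ 2 ->
  m = (norm m * cos beta, norm m * sin beta) ->
  fst p ^ 2 + snd p ^ 2 + 1 = 2 * (fst p * fst m + snd p * snd m) ->
  exists psi, - PI <= psi <= PI /\ p = circle_point m rho (beta + PI + psi).
Proof.
intros Hr Hm Eb Ep.
pose proof (norm_sq m) as En; pose proof (norm_ge0 m).
set (L := norm m) in *.
assert (HL : 0 < L) by nra.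
set (dx := fst p - fst m); set (dy := snd p - snd m).
assert (Ed : dx ^ 2 + dy ^ 2 = rho ^ 2) by (unfold dx, dy; nra).
(* [p - m] in the frame rotated by [beta + PI], whose first axis points from [m] to the origin. *)
set (V := (- (dx * cos beta + dy * sin beta), - (dy * cos beta - dx * sin beta)) : point).
assert (HV : norm V = rho).
{ apply norm_eq_of_sq; [lra |]; unfold V; cbn [fst snd].
  rewrite <- Ed; transitivity ((dx ^ 2 + dy ^ 2) * (cos beta ^ 2 + sin beta ^ 2)); [ring |].
  rewrite cos2_sin2; ring. }
exists (angle V); split.
- unfold angle; pose proof (acos_bound (fst V / norm V)); destruct Rle_dec; lra.
- pose proof (cos_angle V ltac:(lra)) as Ec; pose proof (sin_angle V ltac:(lra)) as Es.
  rewrite HV in Ec, Es; unfold V in Ec at 2; unfold V in Es at 2; cbn [fst snd] in Ec, Es.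
  unfold circle_point; rewrite (surjective_pairing p).
  replace (beta + PI + angle V) with (beta + angle V + PI) by ring.
  rewrite neg_cos, neg_sin, cos_plus, sin_plus.
  pose proof (cos2_sin2 beta) as E1.
  f_equal.
  + transitivity (fst m - (cos beta * (rho * cos (angle V)) - sin beta * (rho * sin (angle V))));
      [| ring].
    rewrite Ec, Es.
    transitivity (fst m + dx * (cos beta ^ 2 + sin beta ^ 2)); [rewrite E1; unfold dx; ring | ring].
  + transitivity (snd m - (sin beta * (rho * cos (angle V)) + cos beta * (rho * sin (angle V))));
      [| ring].
    rewrite Ec, Es.
    transitivity (snd m + dy * (cos beta ^ 2 + sin beta ^ 2)); [rewrite E1; unfold dy; ring | ring].
Qed.

(** On [[-PI, PI]] the cosine decreases with the absolute value, and a point of an interval is no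
    larger in absolute value than one of the ends. *)
Lemma cos_ge_between psi1 psi2 psi : - PI <= psi1 <= PI -> - PI <= psi2 <= PI ->
  Rmin psi1 psi2 <= psi <= Rmax psi1 psi2 -> cos psi1 <= cos psi \/ cos psi2 <= cos psi.
Proof.
intros H1 H2 H; apply Rmin_Rmax_cases in H.
assert (Habs : forall x, cos x = cos (Rabs x)).
{ intros x; unfold Rabs; destruct Rcase_abs; [now rewrite cos_neg | easy]. }
assert (Hle : forall x y, - PI <= x <= PI -> Rabs y <= Rabs x -> cos x <= cos y).
{ intros x y Hx Hy; rewrite (Habs x), (Habs y).
  apply cos_decr_1; try apply Rabs_pos; try easy; try (apply Rabs_le; lra).
  apply Rle_trans with (Rabs x); [easy | apply Rabs_le; lra]. }
destruct (Rle_dec (Rabs psi) (Rabs psi1)) as [G1 | G1]; [left; now apply Hle |].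
destruct (Rle_dec (Rabs psi) (Rabs psi2)) as [G2 | G2]; [right; now apply Hle |].
exfalso; revert G1 G2; unfold Rabs; repeat destruct Rcase_abs; lra.
Qed.

Lemma continuity_chord_coord m rho : fst m ^ 2 + snd m ^ 2 = 1 + rho ^ 2 ->
  continuity (chord_coord m rho).
Proof.
intros Hm t; apply derivable_continuous_pt; eexists.
now apply is_derive_Reals, is_derive_chord_coord.
Qed.

Lemma orthogonal_circle m rho : 0 < rho -> fst m ^ 2 + snd m ^ 2 = 1 + rho ^ 2 ->
  orthogonal_to_unit_circle m rho.
Proof.
intros Hr Hm; split.
(* The point of contact of a tangent from [m] to the unit circle. *)
- exists ((fst m - rho * snd m) / (1 + rho ^ 2), (snd m + rho * fst m) / (1 + rho ^ 2)).
  split; apply norm_eq_of_sq; try lra; unfold psub; cbn [fst snd].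
  + transitivity ((fst m ^ 2 + snd m ^ 2) * (1 + rho ^ 2) / (1 + rho ^ 2) ^ 2);
      [field; nra | rewrite Hm; field; nra].
  + transitivity ((fst m ^ 2 + snd m ^ 2) * (rho ^ 4 + rho ^ 2) / (1 + rho ^ 2) ^ 2);
      [field; nra | rewrite Hm; field; nra].
- intros p H1 H2.
  pose proof (norm_sq p) as N1; pose proof (norm_sq (psub p m)) as N2.
  rewrite H1 in N1; rewrite H2 in N2; unfold dot, psub in *; cbn [fst snd] in *; nra.
Qed.

Lemma circle_segment u v w : disk u -> disk v -> disk w ->
  fst u * snd v <> snd u * fst v -> between (klein u) (klein v) (klein w) ->
  segment u v w.
Proof.
intros Hu Hv Hw Huv Hb.
set (su := fst u ^ 2 + snd u ^ 2); set (sv := fst v ^ 2 + snd v ^ 2).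
set (det := fst u * snd v - snd u * fst v).
assert (Hdet : det <> 0) by (unfold det; lra).
(* Cramer's rule for the centre: a circle of centre [m] orthogonal to the unit circle passes through
   [x] when [|x|^2 + 1 = 2 x . m], imposed here at [u] and [v]. *)
pose (m := (((1 + su) * snd v - (1 + sv) * snd u) / (2 * det),
            ((1 + sv) * fst u - (1 + su) * fst v) / (2 * det)) : point).
assert (Eu : fst u ^ 2 + snd u ^ 2 + 1 = 2 * (fst u * fst m + snd u * snd m)).
{ fold su; unfold m; cbn [fst snd].
  transitivity ((1 + su) * det / det); [field; easy | unfold det at 1; field; easy]. }
assert (Ev : fst v ^ 2 + snd v ^ 2 + 1 = 2 * (fst v * fst m + snd v * snd m)).
{ fold sv; unfold m; cbn [fst snd].
  transitivity ((1 + sv) * det / det); [field; easy | unfold det at 1; field; easy]. }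
clearbody m.
(* Cauchy-Schwarz gives [((1 + su) / 2)^2 <= su |m|^2], while the left side exceeds [su] because
   [su < 1]. *)
assert (Hm : 1 < fst m ^ 2 + snd m ^ 2).
{ apply disk_sq in Hu.
  fold su in Hu, Eu.
  assert (Hs : 0 <= su) by (unfold su; nra).
  assert (Hcs : (fst u * fst m + snd u * snd m) ^ 2 <= su * (fst m ^ 2 + snd m ^ 2)).
  { pose proof (pow2_ge_0 (fst u * snd m - snd u * fst m)); unfold su; nra. }
  apply Rnot_le_lt; intros Hle.
  replace (fst u * fst m + snd u * snd m) with ((su + 1) / 2) in Hcs by lra.
  pose proof (Rmult_le_compat_l su _ _ Hs Hle); nra. }
pose (rho := sqrt (fst m ^ 2 + snd m ^ 2 - 1)).
assert (Hr : 0 < rho) by (apply sqrt_lt_R0; lra).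
assert (Em : fst m ^ 2 + snd m ^ 2 = 1 + rho ^ 2) by (unfold rho; rewrite pow2_sqrt; lra).
clearbody rho.
destruct (polar_form m) as [L [beta [Hpm EL]]]; rewrite EL in Hpm.
destruct (circle_point_polar m rho beta u Hr Em Hpm Eu) as [p1 [B1 E1]].
destruct (circle_point_polar m rho beta v Hr Em Hpm Ev) as [p2 [B2 E2]].
assert (Hcos : forall psi, fst m * cos (beta + PI + psi) + snd m * sin (beta + PI + psi)
  = - (norm m * cos psi)).
{ intros psi; replace (beta + PI + psi) with (beta + psi + PI) by ring.
  rewrite neg_cos, neg_sin, cos_plus, sin_plus.
  assert (M1 : fst m = norm m * cos beta) by (rewrite Hpm at 1; easy).
  assert (M2 : snd m = norm m * sin beta) by (rewrite Hpm at 1; easy).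
  rewrite M1, M2.
  transitivity (- (norm m * cos psi) * (cos beta ^ 2 + sin beta ^ 2)); [ring |].
  rewrite cos2_sin2; ring. }
(* The angles are offsets in [[-PI, PI]] from the direction of the origin, so [cos_ge_between]
   carries the disk condition from the ends to the whole arc. *)
assert (Hdisk : forall t, Rmin (beta + PI + p1) (beta + PI + p2) <= t
    <= Rmax (beta + PI + p1) (beta + PI + p2) -> disk (circle_point m rho t)).
{ intros t Ht.
  apply circle_point_disk; try easy.
  replace t with (beta + PI + (t - beta - PI)) by ring.
  rewrite E1, circle_point_disk, Hcos in Hu by easy.
  rewrite E2, circle_point_disk, Hcos in Hv by easy.
  rewrite Hcos; pose proof (norm_ge0 m).
  destruct (cos_ge_between p1 p2 (t - beta - PI) B1 B2) as [G | G].
  - apply cases_Rmin_Rmax; apply Rmin_Rmax_cases in Ht; lra.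
  - pose proof (Rmult_le_compat_l _ _ _ H G); lra.
  - pose proof (Rmult_le_compat_l _ _ _ H G); lra. }
set (a := beta + PI + p1) in *; set (b := beta + PI + p2) in *.
destruct Hb as [mu [Hmu [F1 F2]]].
(* Some point of the arc has the chord coordinate of [klein w]; injectivity of [klein] then
   identifies it with [w]. *)
destruct (IVT_gen (chord_coord m rho) a b
  ((1 - mu) * chord_coord m rho a + mu * chord_coord m rho b)) as [t [Ht Et]].
{ now apply continuity_chord_coord. }
{ now apply cases_Rmin_Rmax, convex_combination_cases. }
exists (circle_point m rho), a, b.
split; [left; exists m, rho; repeat split; [easy | now apply orthogonal_circle ..] |].
split; [easy |]; split; [easy |]; split; [easy |].
exists t; split; [easy |].
apply klein_inj; [easy | now apply Hdisk |].
rewrite E1, E2, !klein_circle in F1, F2 by easy; rewrite klein_circle, Et by easy.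
cbn [fst snd] in F1, F2; rewrite (surjective_pairing (klein w)), F1, F2; f_equal; ring.
Qed.

Lemma segment_iff u v w : disk u -> disk v ->
  segment u v w <-> disk w /\ between (klein u) (klein v) (klein w).
Proof.
intros Hu Hv; split; [apply segment_klein_between | intros [Hw Hb]].
destruct (Req_dec (fst u * snd v) (snd u * fst v)).
- now apply diameter_segment.
- now apply circle_segment.
Qed.

(** * The isometries [tau] as projective maps *)

(** Numerators and denominator are affine in [klein x], which makes [tau c] projective in the Klein
    model; [D > 0] keeps the disk away from the line sent to infinity. *)
Lemma klein_tau c x : disk c -> disk x ->
  let D := 1 + norm c ^ 2 - 2 * dot c (klein x) in
  0 < D /\ klein (tau c x) =
    ((2 * (1 - dot c (klein x)) * fst c - (1 - norm c ^ 2) * fst (klein x)) / D,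
     (2 * (1 - dot c (klein x)) * snd c - (1 - norm c ^ 2) * snd (klein x)) / D).
Proof.
intros Hc Hx; cbv zeta.
pose proof (tau_denominator_pos c x Hc Hx) as HD.
pose proof (norm_tau c x Hc Hx) as HN.
set (D0 := 1 - 2 * dot c x + norm c ^ 2 * norm x ^ 2) in *.
set (n := 1 + norm x ^ 2).
set (B := 1 - norm c ^ 2) in *.
assert (Hn : 0 < n) by (unfold n; pose proof (pow2_ge_0 (norm x)); lra).
assert (Ek : klein x = (2 * fst x / n, 2 * snd x / n)) by (unfold klein, n; now rewrite norm_sq).
assert (Edot : dot c (klein x) = 2 * dot c x / n)
  by (rewrite Ek; unfold dot; cbn [fst snd]; field; lra).
assert (Et : 1 + norm (tau c x) ^ 2 = ((1 + norm c ^ 2) * n - 4 * dot c x) / D0).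
{ replace (1 + norm (tau c x) ^ 2) with (2 - (1 - norm (tau c x) ^ 2)) by ring.
  rewrite HN; apply Rmult_eq_reg_r with D0; [| lra]; field_simplify; try lra.
  unfold D0, B, n; ring. }
assert (HE : 0 < (1 + norm c ^ 2) * n - 4 * dot c x).
{ assert (H : 0 < 1 + norm (tau c x) ^ 2) by (pose proof (pow2_ge_0 (norm (tau c x))); lra).
  rewrite Et in H; apply Rmult_lt_reg_r with (/ D0); [now apply Rinv_0_lt_compat |].
  unfold Rdiv in H; lra. }
rewrite Edot; split.
- replace (1 + norm c ^ 2 - 2 * (2 * dot c x / n))
    with (((1 + norm c ^ 2) * n - 4 * dot c x) / n) by (field; lra).
  now apply Rdiv_lt_0_compat.
- unfold klein at 1; rewrite <- norm_sq, Et.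
  rewrite Ek; unfold tau; cbn [fst snd].
  fold D0 B.
  replace (1 - 2 * dot c x + norm x ^ 2) with (n - 2 * dot c x) by (unfold n; ring).
  f_equal; field; repeat split; lra.
Qed.

Lemma tau_between c u v w : disk c -> disk u -> disk v -> disk w ->
  between (klein u) (klein v) (klein w) ->
  between (klein (tau c u)) (klein (tau c v)) (klein (tau c w)).
Proof.
intros Hc Hu Hv Hw [mu [Hmu [E1 E2]]].
destruct (klein_tau c u Hc Hu) as [Du ->].
destruct (klein_tau c v Hc Hv) as [Dv ->].
destruct (klein_tau c w Hc Hw) as [Dw ->].
unfold dot in *; rewrite E1, E2 in *.
set (u1 := fst (klein u)) in *; set (u2 := snd (klein u)) in *.
set (v1 := fst (klein v)) in *; set (v2 := snd (klein v)) in *.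
set (N := norm c ^ 2) in *.
set (du := 1 + N - 2 * (fst c * u1 + snd c * u2)) in *.
set (dv := 1 + N - 2 * (fst c * v1 + snd c * v2)) in *.
set (dw := 1 + N - 2 * (fst c * ((1 - mu) * u1 + mu * v1)
  + snd c * ((1 - mu) * u2 + mu * v2))) in *.
assert (Ed : dw = (1 - mu) * du + mu * dv) by (unfold dw, du, dv; ring).
(* A projective map multiplies the weights [1 - mu] and [mu] by the denominators at [u] and [v];
   [dw] normalises them. *)
exists (mu * dv / dw); cbn [fst snd]; split.
- split.
  + apply Rmult_le_pos; [apply Rmult_le_pos; lra | left; now apply Rinv_0_lt_compat].
  + apply Rmult_le_reg_r with dw; [easy |]; field_simplify; nra.
- replace (1 - mu * dv / dw) with ((1 - mu) * du / dw)
    by (replace ((1 - mu) * du) with (dw - mu * dv) by lra; field; lra).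
  split; field; lra.
Qed.

(** * Dilations in the Klein model *)

Lemma exp_double r : exp (2 * r) = exp r * exp r.
Proof. rewrite <- exp_plus; f_equal; ring. Qed.

Lemma tanh_eq r : tanh r = (exp (2 * r) - 1) / (exp (2 * r) + 1).
Proof. rewrite <- tanh_exp; f_equal; field. Qed.

Lemma tanh_bounds r : 0 < r -> 0 < tanh r < 1.
Proof.
intros Hr; rewrite tanh_eq; pose proof (exp_gt_1 (2 * r) ltac:(lra)).
split; [apply Rdiv_lt_0_compat; lra |].
apply Rmult_lt_reg_r with (exp (2 * r) + 1); [lra |]; field_simplify; lra.
Qed.

Lemma tanh_0 : tanh 0 = 0.
Proof. unfold tanh; rewrite sinh_0; apply Rmult_0_l. Qed.

Lemma artanh_tanh r : artanh (tanh r) = r.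
Proof.
unfold artanh; rewrite tanh_eq; pose proof (exp_pos (2 * r)).
replace ((1 + _) / _) with (exp (2 * r)) by (field; repeat split; lra).
rewrite ln_exp; field.
Qed.

Lemma tanh_artanh s : -1 < s < 1 -> tanh (artanh s) = s.
Proof.
intros Hs; rewrite tanh_eq; unfold artanh.
replace (2 * (ln ((1 + s) / (1 - s)) / 2)) with (ln ((1 + s) / (1 - s))) by field.
rewrite exp_ln by (apply Rdiv_lt_0_compat; lra); field; lra.
Qed.

Lemma tanh_le r s : tanh r <= tanh s -> r <= s.
Proof.
intros H; apply Rnot_lt_le; intros Hlt.
assert (E : tanh s < tanh r).
{ rewrite !tanh_eq; pose proof (exp_pos (2 * s)).
  pose proof (exp_increasing (2 * s) (2 * r) ltac:(lra)).
  apply Rmult_lt_reg_r with ((exp (2 * s) + 1) * (exp (2 * r) + 1));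
    [apply Rmult_lt_0_compat; lra |].
  field_simplify; lra. }
lra.
Qed.

Lemma gauge_tanh h q : 0 < h -> 0 < q -> gauge h q = q / tanh (q * h).
Proof.
intros Hh Hq; rewrite tanh_eq; unfold gauge.
pose proof (exp_gt_1 (2 * (q * h)) ltac:(nra)); field; lra.
Qed.

Lemma klein_X r theta : klein (X r theta) = (tanh r * cos theta, tanh r * sin theta).
Proof.
unfold X; rewrite klein_diameter, tanh_exp, tanh_eq, exp_double; pose proof (exp_pos r).
f_equal; field; nra.
Qed.

Lemma disk_X r theta : 0 < r -> disk (X r theta).
Proof.
intros Hr; apply diameter_disk; pose proof (tanh_bounds (r / 2)); lra.
Qed.

Lemma disk_polar p : disk p -> p = origin \/ exists r theta, 0 < r /\ p = X r theta.
Proof.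
intros Hp; destruct (Req_dec (norm p) 0) as [H | H].
- left; destruct (polar_form p) as [r [alpha [-> Hr]]].
  rewrite Hr, H; unfold origin; f_equal; ring.
- right; exists (hdist0 p), (angle p); rewrite X_polar by easy; split; [| easy].
  unfold disk in Hp; pose proof (norm_ge0 p); unfold hdist0; rewrite <- ln_1.
  apply ln_increasing; [lra |].
  apply Rmult_lt_reg_r with (1 - norm p); [lra |]; field_simplify; lra.
Qed.

Lemma dilation0_origin k1 k2 : dilation0 k1 k2 origin = origin.
Proof.
unfold dilation0; destruct Req_EM_T as [_ | H]; [easy |].
exfalso; apply H, norm_eq_of_sq; [lra |]; unfold origin; cbn; ring.
Qed.

Lemma stretched_norm_direction_pos k1 k2 theta : 1 <= k1 -> 1 <= k2 ->
  0 < stretched_norm k1 k2 (cos theta) (sin theta).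
Proof.
intros; apply stretched_norm_pos; try easy; pose proof (cos2_sin2 theta); lra.
Qed.

Lemma stretched_norm_scal k1 k2 s x y : 0 <= s ->
  stretched_norm k1 k2 (s * x) (s * y) = s * stretched_norm k1 k2 x y.
Proof.
intros Hs; unfold stretched_norm.
replace ((k1 * (s * x)) ^ 2 + (k2 * (s * y)) ^ 2)
  with (s ^ 2 * ((k1 * x) ^ 2 + (k2 * y) ^ 2)) by ring.
rewrite sqrt_mult_alt, sqrt_pow2; nra.
Qed.

Lemma stretched_norm_1 theta : stretched_norm 1 1 (cos theta) (sin theta) = 1.
Proof.
unfold stretched_norm; rewrite !Rmult_1_l, cos2_sin2; apply sqrt_1.
Qed.

Lemma dilation0_polar k1 k2 r theta : 1 <= k1 -> 1 <= k2 -> 0 < r ->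
  let kappa := stretched_norm k1 k2 (cos theta) (sin theta) in
  exists theta', kappa * cos theta' = k1 * cos theta /\ kappa * sin theta' = k2 * sin theta /\
    dilation0 k1 k2 (X r theta) = X (r * kappa) theta'.
Proof.
intros H1 H2 Hr kappa.
pose proof (stretched_norm_direction_pos k1 k2 theta H1 H2) as Hk; fold kappa in Hk.
assert (En : norm (k1 * cos theta, k2 * sin theta) = kappa).
{ apply norm_eq_of_sq; [lra |]; cbn [fst snd]; unfold kappa.
  rewrite stretched_norm_sq; ring. }
exists (angle (k1 * cos theta, k2 * sin theta)).
rewrite <- En, cos_angle, sin_angle by lra; rewrite En.
split; [easy | split; [easy |]].
rewrite dilation0_X by easy; f_equal; f_equal; unfold kappa, stretched_norm.
f_equal; ring.
Qed.

Lemma klein_dilation0 k1 k2 r theta : 1 <= k1 -> 1 <= k2 -> 0 < r ->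
  let kappa := stretched_norm k1 k2 (cos theta) (sin theta) in
  klein (dilation0 k1 k2 (X r theta)) =
  (tanh (r * kappa) / kappa * (k1 * cos theta), tanh (r * kappa) / kappa * (k2 * sin theta)).
Proof.
intros H1 H2 Hr kappa.
pose proof (stretched_norm_direction_pos k1 k2 theta H1 H2) as Hk; fold kappa in Hk.
destruct (dilation0_polar k1 k2 r theta H1 H2 Hr) as [t [E1 [E2 ->]]]; fold kappa in E1, E2 |- *.
rewrite klein_X, <- E1, <- E2; f_equal; field; lra.
Qed.

Lemma disk_dilation0 k1 k2 p : 1 <= k1 -> 1 <= k2 -> disk p -> disk (dilation0 k1 k2 p).
Proof.
intros H1 H2 Hp; destruct (disk_polar p Hp) as [-> | [r [theta [Hr ->]]]].
- now rewrite dilation0_origin.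
- destruct (dilation0_polar k1 k2 r theta H1 H2 Hr) as [t [_ [_ ->]]].
  apply disk_X, Rmult_lt_0_compat; [easy | now apply stretched_norm_direction_pos].
Qed.

(** * Convexity of the image under dilations about the origin *)

(** Convexity of the Klein image, stated on points of the Poincaré disk so that [klein] need not be
    inverted. *)
Definition klein_convex (S : point -> Prop) : Prop :=
  (forall u, S u -> disk u) /\
  (forall u v w, S u -> S v -> disk w -> between (klein u) (klein v) (klein w) -> S w).

Lemma klein_origin : klein origin = origin.
Proof. unfold klein, origin; cbn [fst snd]; f_equal; field. Qed.

Lemma klein_convex_shrink S r s theta : klein_convex S -> S origin ->
  0 < s <= r -> S (X r theta) -> S (X s theta).
Proof.
intros [_ HS] H0 Hs Hr; apply (HS origin (X r theta)); try easy; [apply disk_X; lra |].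
rewrite klein_origin, !klein_X.
pose proof (tanh_bounds r ltac:(lra)); pose proof (tanh_bounds s ltac:(lra)).
assert (tanh s <= tanh r).
{ apply Rnot_lt_le; intros Hlt; pose proof (tanh_le r s ltac:(lra)).
  replace s with r in Hlt by lra; lra. }
exists (tanh s / tanh r); unfold origin; cbn [fst snd]; split; [split |].
- left; apply Rdiv_lt_0_compat; lra.
- apply Rmult_le_reg_r with (tanh r); [lra |]; field_simplify; lra.
- split; field; lra.
Qed.

(** The Klein image of [X s phi] is [q] times the stretched direction [theta], and comparing lengths
    gives [tanh s]. On the ray [theta] distances are multiplied by [kappa], so the preimage lies at
    distance [s / kappa <= r], within reach of [klein_convex_shrink]. *)
Lemma image_dilation0_ray S k1 k2 r theta s q phi : klein_convex S -> S origin ->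
  1 <= k1 -> 1 <= k2 -> 0 < r -> 0 < s -> 0 <= q ->
  let kappa := stretched_norm k1 k2 (cos theta) (sin theta) in
  S (X r theta) ->
  tanh s * cos phi = q * (k1 * cos theta) -> tanh s * sin phi = q * (k2 * sin theta) ->
  tanh s = q * kappa /\ (s <= r * kappa -> image (dilation0 k1 k2) S (X s phi)).
Proof.
intros HS H0 H1 H2 Hr Hs Hq kappa Hy E1 E2.
pose proof (stretched_norm_direction_pos k1 k2 theta H1 H2) as Hk; fold kappa in Hk.
pose proof (tanh_bounds s Hs) as Ht.
assert (E : tanh s = q * kappa).
{ apply Rsqr_inj; [lra | nra |]; unfold Rsqr.
  transitivity ((tanh s * cos phi) ^ 2 + (tanh s * sin phi) ^ 2).
  { rewrite diameter_sq; ring. }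
  rewrite E1, E2; transitivity (q ^ 2 * kappa ^ 2); [| ring].
  unfold kappa; rewrite stretched_norm_sq; ring. }
split; [easy |]; intros Hle.
assert (Hz : 0 < s / kappa) by now apply Rdiv_lt_0_compat.
exists (X (s / kappa) theta); split.
- apply klein_convex_shrink with r; try easy; split; [easy |].
  apply Rmult_le_reg_r with kappa; [easy |]; field_simplify; lra.
- destruct (dilation0_polar k1 k2 (s / kappa) theta H1 H2 Hz) as [t [F1 [F2 ->]]].
  fold kappa in F1, F2 |- *.
  replace (s / kappa * kappa) with s by (field; lra).
  assert (cos phi = cos t).
  { apply Rmult_eq_reg_l with (tanh s); [| lra]; rewrite E1, <- F1, E; ring. }
  assert (sin phi = sin t).
  { apply Rmult_eq_reg_l with (tanh s); [| lra]; rewrite E2, <- F2, E; ring. }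
  unfold X; now f_equal; f_equal.
Qed.

(** The image is star-shaped about the origin. This settles chords with an end at the origin and the
    weights 0 and 1, where the gauge argument does not apply. *)
Lemma image_dilation0_shrink S k1 k2 y w mu : klein_convex S -> S origin ->
  1 <= k1 -> 1 <= k2 -> S y -> disk w -> 0 <= mu <= 1 ->
  fst (klein w) = mu * fst (klein (dilation0 k1 k2 y)) ->
  snd (klein w) = mu * snd (klein (dilation0 k1 k2 y)) ->
  image (dilation0 k1 k2) S w.
Proof.
intros HS H0 H1 H2 Hy Hw Hmu E1 E2.
assert (Horig : image (dilation0 k1 k2) S origin)
  by (exists origin; now rewrite dilation0_origin).
destruct (disk_polar w Hw) as [-> | [s [phi [Hs ->]]]]; [easy |].
destruct (disk_polar y) as [-> | [r [theta [Hr ->]]]]; [now apply HS | |].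
- rewrite dilation0_origin, klein_origin in E1, E2; unfold origin in E1, E2; cbn [fst snd] in E1, E2.
  replace (X s phi) with origin; [easy |].
  apply klein_inj; try easy; [apply disk_sq; cbn; lra |].
  rewrite klein_origin, (surjective_pairing (klein (X s phi))), E1, E2.
  unfold origin; f_equal; ring.
- rewrite klein_dilation0, klein_X in E1, E2 by easy; cbn [fst snd] in E1, E2.
  pose proof (stretched_norm_direction_pos k1 k2 theta H1 H2) as Hk.
  set (kappa := stretched_norm k1 k2 (cos theta) (sin theta)) in *.
  pose proof (tanh_bounds (r * kappa) ltac:(now apply Rmult_lt_0_compat)) as Ht.
  destruct (image_dilation0_ray S k1 k2 r theta s (mu * (tanh (r * kappa) / kappa)) phi)
    as [F G]; try easy; try lra.
  { apply Rmult_le_pos; [easy |]; left; apply Rdiv_lt_0_compat; lra. }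
  apply G, tanh_le; rewrite F; fold kappa.
  replace (mu * (tanh (r * kappa) / kappa) * kappa) with (mu * tanh (r * kappa))
    by (field; lra).
  nra.
Qed.

(** The undilated direction [theta] of [w] meets the chord from [u] to [v] in a point of [S];
    [gauge_sum_flow] shows that dilating this point leads at least as far out as [w]. *)
Lemma image_dilation0_convex S k1 k2 u v w : klein_convex S -> S origin ->
  1 <= k1 -> 1 <= k2 -> S u -> S v -> disk w ->
  between (klein (dilation0 k1 k2 u)) (klein (dilation0 k1 k2 v)) (klein w) ->
  image (dilation0 k1 k2) S w.
Proof.
intros HS H0 H1 H2 Hu Hv Hw [mu [Hmu [E1 E2]]].
assert (K0 : klein (dilation0 k1 k2 origin) = (0, 0))
  by now rewrite dilation0_origin, klein_origin.
destruct (disk_polar u) as [-> | [r1 [t1 [Hr1 ->]]]]; [now apply HS | |].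
{ rewrite K0 in E1, E2; cbn [fst snd] in E1, E2.
  apply image_dilation0_shrink with v mu; try easy; lra. }
destruct (disk_polar v) as [-> | [r2 [t2 [Hr2 ->]]]]; [now apply HS | |].
{ rewrite K0 in E1, E2; cbn [fst snd] in E1, E2.
  apply image_dilation0_shrink with (X r1 t1) (1 - mu); try easy; lra. }
destruct (Req_dec mu 0) as [-> | Hmu0].
{ apply image_dilation0_shrink with (X r1 t1) 1; try easy; lra. }
destruct (Req_dec mu 1) as [-> | Hmu1].
{ apply image_dilation0_shrink with (X r2 t2) 1; try easy; lra. }
destruct (disk_polar w Hw) as [-> | [s [phi [Hs ->]]]].
{ exists origin; now rewrite dilation0_origin. }
rewrite !klein_dilation0, klein_X in E1, E2 by easy; cbn [fst snd] in E1, E2.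
pose proof (stretched_norm_direction_pos k1 k2 t1 H1 H2) as Hk1.
pose proof (stretched_norm_direction_pos k1 k2 t2 H1 H2) as Hk2.
set (kap1 := stretched_norm k1 k2 (cos t1) (sin t1)) in *.
set (kap2 := stretched_norm k1 k2 (cos t2) (sin t2)) in *.
pose proof (tanh_bounds (r1 * kap1) ltac:(now apply Rmult_lt_0_compat)) as T1.
pose proof (tanh_bounds (r2 * kap2) ltac:(now apply Rmult_lt_0_compat)) as T2.
(* With these weights [klein w] is [diag(k1, k2)] applied to [s1 e1 + s2 e2], where [e1] and [e2]
   are the unit vectors of angles [t1] and [t2]. *)
set (s1 := (1 - mu) * (tanh (r1 * kap1) / kap1)).
set (s2 := mu * (tanh (r2 * kap2) / kap2)).
assert (S1 : 0 < s1) by (apply Rmult_lt_0_compat; [lra | apply Rdiv_lt_0_compat; lra]).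
assert (S2 : 0 < s2) by (apply Rmult_lt_0_compat; [lra | apply Rdiv_lt_0_compat; lra]).
destruct (polar_form (s1 * cos t1 + s2 * cos t2, s1 * sin t1 + s2 * sin t2))
  as [rho [theta [Ep Erho]]].
injection Ep as Ec Es.
assert (F1 : tanh s * cos phi = rho * (k1 * cos theta)).
{ rewrite E1; transitivity (k1 * (rho * cos theta)); [rewrite <- Ec; unfold s1, s2 | ]; ring. }
assert (F2 : tanh s * sin phi = rho * (k2 * sin theta)).
{ rewrite E2; transitivity (k2 * (rho * sin theta)); [rewrite <- Es; unfold s1, s2 | ]; ring. }
pose proof (tanh_bounds s Hs) as Ts.
assert (Hrho : 0 < rho).
{ destruct (Rle_lt_or_eq_dec 0 rho) as [| E0]; [rewrite Erho; apply norm_ge0 | easy |].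
  subst rho; rewrite <- E0 in F1, F2.
  pose proof (diameter_sq phi (tanh s)) as Hd; rewrite F1, F2 in Hd; nra. }
assert (D1 : 0 < r1 / s1) by now apply Rdiv_lt_0_compat.
assert (D2 : 0 < r2 / s2) by now apply Rdiv_lt_0_compat.
assert (Hunit : forall x t, 0 < x -> 0 < (x * cos t) ^ 2 + (x * sin t) ^ 2)
  by (intros; rewrite diameter_sq; nra).
(* For these [h] the gauges at [(k1, k2)] are the weights [1 - mu] and [mu], of sum 1; those at the
   identity are [sig1] and [sig2] below. *)
pose proof (gauge_sum_flow k1 k2 (r1 / s1) (r2 / s2)
  (s1 * cos t1) (s1 * sin t1) (s2 * cos t2) (s2 * sin t2) H1 H2 D1 D2
  (Hunit _ _ S1) (Hunit _ _ S2)) as Hflow.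
rewrite Ec, Es in Hflow; specialize (Hflow (Hunit _ _ Hrho)); cbv beta zeta in Hflow.
rewrite !stretched_norm_scal, !stretched_norm_1, !Rmult_1_r in Hflow by lra.
fold kap1 kap2 in Hflow.
pose proof (stretched_norm_direction_pos k1 k2 theta H1 H2) as Hk.
set (kap := stretched_norm k1 k2 (cos theta) (sin theta)) in *.
assert (G1 : gauge (r1 / s1) (s1 * kap1) = 1 - mu).
{ rewrite gauge_tanh by (try easy; now apply Rmult_lt_0_compat).
  replace (s1 * kap1 * (r1 / s1)) with (r1 * kap1) by (field; lra).
  unfold s1; field; lra. }
assert (G2 : gauge (r2 / s2) (s2 * kap2) = mu).
{ rewrite gauge_tanh by (try easy; now apply Rmult_lt_0_compat).
  replace (s2 * kap2 * (r2 / s2)) with (r2 * kap2) by (field; lra).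
  unfold s2; field; lra. }
rewrite G1, G2 in Hflow.
replace (rho * kap / (1 - mu + mu)) with (rho * kap) in Hflow by (field; lra).
pose proof (gauge_gt (r1 / s1) s1 D1 S1) as L1.
pose proof (gauge_gt (r2 / s2) s2 D2 S2) as L2.
set (sig1 := gauge (r1 / s1) s1) in *; set (sig2 := gauge (r2 / s2) s2) in *.
assert (I1 : sig1 * tanh r1 = s1).
{ unfold sig1; rewrite gauge_tanh by easy.
  replace (s1 * (r1 / s1)) with r1 by (field; lra).
  pose proof (tanh_bounds r1 Hr1); field; lra. }
assert (I2 : sig2 * tanh r2 = s2).
{ unfold sig2; rewrite gauge_tanh by easy.
  replace (s2 * (r2 / s2)) with r2 by (field; lra).
  pose proof (tanh_bounds r2 Hr2); field; lra. }
(* The triangle inequality, together with [s1 < sig1] and [s2 < sig2]. *)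
assert (Hlt : rho < sig1 + sig2).
{ apply Rle_lt_trans with (s1 + s2); [| lra].
  apply Rsqr_incr_0_var; [| lra]; unfold Rsqr.
  pose proof (diameter_sq theta rho) as Hd; rewrite <- Ec, <- Es in Hd.
  pose proof (COS_bound (t1 - t2)) as Hc; rewrite cos_minus in Hc.
  pose proof (diameter_sq t1 s1); pose proof (diameter_sq t2 s2).
  assert (0 < s1 * s2) by now apply Rmult_lt_0_compat.
  nra. }
set (r := artanh (rho / (sig1 + sig2))) in *.
assert (Hx : 0 < rho / (sig1 + sig2) < 1).
{ split; [apply Rdiv_lt_0_compat; lra |].
  apply Rmult_lt_reg_r with (sig1 + sig2); [lra |]; field_simplify; lra. }
assert (Er : tanh r = rho / (sig1 + sig2)) by (apply tanh_artanh; lra).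
assert (Hr : 0 < r).
{ destruct (tanh_le 0 r) as [| E0]; [rewrite tanh_0; lra | easy |].
  rewrite <- E0, tanh_0 in Er; lra. }
assert (Hy : S (X r theta)).
{ apply (proj2 HS (X r1 t1) (X r2 t2)); try easy; [now apply disk_X |].
  (* Weights proportional to [sig1] and [sig2] turn the Klein radii [tanh r1] and [tanh r2] into
     multiples of [s1] and [s2], hence give the direction [theta]. *)
  rewrite !klein_X, Er; exists (sig2 / (sig1 + sig2)); cbn [fst snd].
  split; [split |].
  - left; apply Rdiv_lt_0_compat; lra.
  - apply Rmult_le_reg_r with (sig1 + sig2); [lra |]; field_simplify; lra.
  - split.
    + transitivity ((rho * cos theta) / (sig1 + sig2)); [field; lra |].
      rewrite <- Ec, <- I1, <- I2; field; lra.
    + transitivity ((rho * sin theta) / (sig1 + sig2)); [field; lra |].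
      rewrite <- Es, <- I1, <- I2; field; lra. }
destruct (image_dilation0_ray S k1 k2 r theta s rho phi HS H0 H1 H2 Hr Hs) as [G H]; try easy.
{ lra. }
(* What is left is [s <= r kap]; the flow inequality reads [s / (rho kap) <= r / rho]. *)
apply H; fold kap in G |- *.
rewrite <- G, artanh_tanh in Hflow.
assert (0 < rho * kap) by now apply Rmult_lt_0_compat.
apply (Rmult_le_compat_r (rho * kap)) in Hflow; [| lra].
rewrite G in Hflow.
replace (s / (rho * kap) * (rho * kap)) with s in Hflow by (field; lra).
replace (r / rho * (rho * kap)) with (r * kap) in Hflow by (field; lra).
easy.
Qed.

(** * Reduction to dilations about the origin *)

Lemma tau_origin c : tau c origin = c.
Proof.
rewrite (surjective_pairing c) at 2; unfold tau, dot.
rewrite (norm_sq origin); unfold origin; cbn [fst snd]; f_equal; field.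
Qed.

Theorem theorem1 (C : point -> Prop) (c : point) (k1 k2 : R)
    (hC : hyperbolic_convex C) (hc : C c) (hk1 : 1 <= k1) (hk2 : 1 <= k2) :
  hyperbolic_convex (image (dilation c k1 k2) C).
Proof.
destruct hC as [Cdisk Cseg].
pose proof (Cdisk c hc) as Hc.
(* The copy of [C] under the isometry [tau c], which moves [c] to the origin. *)
pose (S := fun x => disk x /\ C (tau c x)).
assert (HS : klein_convex S).
{ split; [now intros u [Hu _] |].
  intros u v w [Hu Cu] [Hv Cv] Hw Hb; split; [easy |].
  apply (Cseg _ _ Cu Cv); apply segment_iff; try now apply tau_disk.
  split; [now apply tau_disk | now apply tau_between]. }
assert (H0 : S origin).
{ split; [apply disk_sq; cbn; lra | now rewrite tau_origin]. }
assert (HSt : forall x, C x -> S (tau c x)).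
{ intros x Cx; pose proof (Cdisk x Cx); split; [now apply tau_disk |].
  now rewrite tau_involutive. }
assert (Hdil : forall x, C x -> disk (dilation0 k1 k2 (tau c x))).
{ intros x Cx; apply disk_dilation0; try easy; now apply HSt. }
split.
- intros y [x [Cx ->]]; apply tau_disk; auto.
- intros y1 y2 [u [Cu ->]] [v [Cv ->]] w Hseg; unfold dilation in Hseg.
  apply segment_iff in Hseg as [Hw Hb]; try (apply tau_disk; auto).
  (* Applying [tau c] to the chord strips the outer isometry from its two dilated ends. *)
  apply (tau_between c) in Hb; try (apply tau_disk; now auto); try easy.
  rewrite !tau_involutive in Hb by auto.
  destruct (image_dilation0_convex S k1 k2 (tau c u) (tau c v) (tau c w))
    as [z [[Hz Cz] Ez]]; auto; [now apply tau_disk |].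
  exists (tau c z); split; [easy |].
  unfold dilation; rewrite tau_involutive, <- Ez, tau_involutive by easy; easy.
Qed.
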